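(* Suppose that, for any $\alpha,\beta\in\{1,2\}$, $f_{\alpha\beta}(x)=\Phi_{\alpha\beta}^{+}(|x|)-\Phi_{\alpha\beta}^{-}(|x|)$ for convex and strongly tempered functions $\Phi_{\alpha\beta}^{\pm}:[0,\infty)\to\mathbb{R}$, where strongly tempered means that there exist $r_0,C,\eta>0$ such that $|\Phi_{\alpha\beta}^{\pm}(r)|<C r^{-1-\eta}$ for all $r>r_0$. Let $\mathcal{F}=(f_{11},f_{22},f_{12})$. Moreover, suppose that the function $$F(r):=2\Phi_{12}^{+}(r)-\sum_{k=1}^{\infty}\Big(2\Phi_{12}^{-}\big((2k-1)r\big)+\Phi_{22}^{-}(2kr)+\Phi_{11}^{-}(2kr)\Big)$$ is convex on $(0,+\infty)$. Then the equidistant configuration is the unique minimizer of $E_{\mathcal{F}}$ at any scale, i.e. for every $\rho>0$ and every $N\in 2\mathbb{N}$, $e^{\rho}$ is the unique minimizer of $E_{\mathcal{F}}$ in $\mathcal{A}_N^{\rho}$.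
   Context: For $\rho>0$ and a positive even integer $N$ (written $N\in 2\mathbb{N}$), let $$\mathcal{A}_N^{\rho}=\{(x_k)_{k\in\mathbb{Z}}\subset\mathbb{R}:\ x_0=0,\ x_k<x_{k+1}\text{ and }x_{k+N}=x_k+\rho^{-1}N\ \text{ for all }k\in\mathbb{Z}\}$$ be the class of $N$-periodic configurations of density $\rho$. The particle $x_k$ is of type $\epsilon_k$, where $\epsilon_k=1$ if $k$ is odd and $\epsilon_k=2$ if $k$ is even. The equidistant configuration is $e^{\rho}:=(k\rho^{-1})_{k\in\mathbb{Z}}\in\mathcal{A}_N^{\rho}$. Given mirror symmetric interaction potentials $f_{\alpha\beta}:\mathbb{R}\to\mathbb{R}$, $\alpha,\beta\in\{1,2\}$ (i.e. $f_{\alpha\beta}(-x)=f_{\alpha\beta}(x)$), with $f_{21}=f_{12}$, and $\mathcal{F}=(f_{11},f_{22},f_{12})$, the energy of $X=(x_i)_{i\in\mathbb{Z}}\in\mathcal{A}_N^{\rho}$ is $$E_{\mathcal{F}}(X)=\frac1N\sum_{n=1}^{N}\ \sum_{k\in\mathbb{Z},\,k\neq n} f_{\epsilon_n\epsilon_k}(x_k-x_n).$$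
   Formalization: Uniqueness is proved only when Φ₁₂⁺ is strictly convex on (0,∞); with merely convex data it fails (all Φ^± = 0, N = 2). That e^ρ is a minimizer is proved under the stated hypotheses for every ρ > 0 and even N. *)

(* Defs.v *)
From HB Require Import structures.
From mathcomp Require Import all_boot all_order all_algebra.
From mathcomp Require Import all_classical all_reals all_analysis.

Set Implicit Arguments.
Unset Strict Implicit.
Unset Printing Implicit Defensive.

Import Order.TTheory GRing.Theory Num.Theory.
Import numFieldNormedType.Exports.

Local Open Scope classical_set_scope.
Local Open Scope ring_scope.

Inductive species := Sp1 | Sp2.

Definition species_of (k : int) : species := if odd `|k|%N then Sp1 else Sp2.

(* Sum over Z as the sum of two one-sided series, k = 0, 1, 2, ... and
   k = -1, -2, ... ([Negz j] is - j.+1). It is the unconditional sum whenever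
   the family is absolutely summable; otherwise its value is meaningless. *)
Definition sumZ (R : realType) (g : int -> R) : R :=
  limn (series (fun j : nat => g (Posz j))) +
  limn (series (fun j : nat => g (Negz j))).

Definition periodic_conf (R : realType) (rho : R) (N : nat) : set (int -> R) :=
  [set x | [/\ x 0 = 0,
               (forall k : int, x k < x (k + 1)) &
               (forall k : int, x (k + N%:Z) = x k + rho^-1 * N%:R)]].

Definition equidistant (R : realType) (rho : R) : int -> R :=
  fun k => k%:~R * rho^-1.

Definition energy (R : realType) (f : species -> species -> R -> R) (N : nat)
    (x : int -> R) : R :=
  N%:R^-1 * \sum_(1 <= n < N.+1)
    sumZ (fun k : int => if k == n%:Z then 0
                         else f (species_of n%:Z) (species_of k)
                                (x k - x n%:Z)).

Definition strongly_tempered (R : realType) (Phi : R -> R) : Prop :=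
  exists r0 C eta : R, [/\ 0 < r0, 0 < C, 0 < eta &
    forall r : R, r0 < r -> `|Phi r| < C * r `^ (- 1 - eta)].

(* The series runs over k.+1, k = 0, 1, 2, ... *)
Definition nn_potential (R : realType) (Phip Phim : species -> species -> R -> R)
    (r : R) : R :=
  2 * Phip Sp1 Sp2 r -
  limn (series (fun k : nat =>
    2 * Phim Sp1 Sp2 ((2 * k.+1 - 1)%N%:R * r)
    + Phim Sp2 Sp2 ((2 * k.+1)%N%:R * r)
    + Phim Sp1 Sp1 ((2 * k.+1)%N%:R * r))).

(* Non-strict convexity of all the data does not force uniqueness of the
   minimizer (take every function to be 0), so the uniqueness part of the
   theorem uses strict convexity of [Phip Sp1 Sp2] on ]0, +oo[. As
   2 * Phip Sp1 Sp2 is [nn_potential Phip Phim] plus a convergent sum of convex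
   functions, this holds as soon as [nn_potential Phip Phim], [Phim Sp1 Sp2],
   [Phim Sp1 Sp1] or [Phim Sp2 Sp2] is strictly convex. *)
Definition strictly_convex_function (R : realType) (D : set R) (f : R -> R)
    : Prop :=
  forall t x y : R, 0 < t < 1 -> D x -> D y -> x != y ->
    f (t * x + (1 - t) * y) < t * f x + (1 - t) * f y.

Definition is_minimizer (R : realType) (T : Type) (E : T -> R) (A : set T)
    (x : T) : Prop :=
  A x /\ forall y, A y -> E x <= E y.

Definition is_unique_minimizer (R : realType) (T : Type) (E : T -> R)
    (A : set T) (x : T) : Prop :=
  is_minimizer E A x /\ forall y, is_minimizer E A y -> y = x.

(* Main.v *)
(* Up to a factor, the energy is the sum over k >= 1 of the k-th neighbour
   interactions over one period, and the mean of the k-th neighbour distances is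
   k / rho. Jensen's inequality applied to these distances bounds the Phi^+ part
   of every k > 1 from below by its value at the equidistant configuration. For
   the Phi^- part each k-th neighbour distance is written as the mean of k times
   the gaps it contains; Jensen's inequality then replaces
   Phi^-(x_{n+k} - x_n) by an average of Phi^-(k gap). Together with the Phi^+
   part of k = 1 this leaves half the sum of F over the gaps, and Jensen's
   inequality for F concludes.
   F may be affine, so uniqueness is instead read off from the Jensen deficits of
   Phi_12^+ at k = 3 and k = 5. *)

Require Import Defs.
From HB Require Import structures.
From mathcomp Require Import all_boot all_order all_algebra.
From mathcomp Require Import all_classical all_reals all_analysis.
From mathcomp Require Import zify ring lra.

Import Order.TTheory GRing.Theory Num.Theory.
Import numFieldNormedType.Exports.

Local Open Scope classical_set_scope.
Local Open Scope ring_scope.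

(** * Convex and strongly tempered functions *)

Lemma convex_functionP {R : realType} (D : set R) (f : R -> R) (t x y : R) :
  convex_function D f -> 0 <= t <= 1 -> D x -> D y ->
  f (t * x + (1 - t) * y) <= t * f x + (1 - t) * f y.
Proof.
move=> cf /andP[t0 t1] Dx Dy.
have := cf (@Itv01 R t t0 t1) x y (mem_set Dx) (mem_set Dy).
by rewrite !convRE /=.
Qed.

(** The point [p] is the convex combination of [y] and [z] with weight [(z - p) / (z - y)] on [y];
    clearing denominators turns convexity into a comparison of the left and right chord slopes at
    [p]. *)
Lemma convex_slopes {R : realType} (f : R -> R) (y p z : R) :
  convex_function (`]0, +oo[%classic : set R) f -> 0 < y -> y < p -> p < z ->
  (f p - f y) * (z - p) <= (f z - f p) * (p - y).
Proof.
move=> cf y0 yp pz; have zy : 0 < z - y by lra.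
have t01 : 0 <= (z - p) / (z - y) <= 1.
  by rewrite divr_ge0 ?ler_pdivrMr//; lra.
have Dy : `]0, +oo[%classic y by rewrite /= in_itv/= y0.
have Dz : `]0, +oo[%classic z by rewrite /= in_itv/= andbT; lra.
have := convex_functionP _ _ _ _ _ cf t01 Dy Dz.
have -> : (z - p) / (z - y) * y + (1 - (z - p) / (z - y)) * z = p.
  by field; rewrite gt_eqF.
rewrite -(ler_pM2r zy).
have -> : ((z - p) / (z - y) * f y + (1 - (z - p) / (z - y)) * f z) * (z - y)
  = (z - p) * f y + (p - y) * f z by field; rewrite gt_eqF.
lra.
Qed.

(** The slope [s] is the supremum of the left chord slopes at [p], and every right chord slope
    bounds it from above. All Jensen inequalities below rest on this line. *)
Lemma convex_supporting_line {R : realType} (f : R -> R) (p : R) :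
  convex_function (`]0, +oo[%classic : set R) f -> 0 < p ->
  exists s, forall y, 0 < y -> f p + s * (y - p) <= f y.
Proof.
move=> cf p0.
pose S := [set (f p - f y) / (p - y) | y in [set y | 0 < y < p]].
have S0 : S !=set0.
  by exists ((f p - f (p / 2)) / (p - p / 2)), (p / 2) => //=; lra.
have ubS z : p < z -> ubound S ((f z - f p) / (z - p)).
  move=> pz _ [y /= /andP[y0 yp] <-]; rewrite ler_pdivrMr; last lra.
  rewrite mulrAC ler_pdivlMr; last lra.
  exact: convex_slopes.
have hS : has_sup S.
  by split => //; exists ((f (p + 1) - f p) / (p + 1 - p)); apply: ubS; lra.
exists (sup S) => y y0; have [yp|py|->] := ltgtP y p; last lra.
- have : (f p - f y) / (p - y) <= sup S.
    by apply: (ub_le_sup hS.2); exists y => //=; rewrite y0.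
  rewrite ler_pdivrMr; last lra.
  lra.
- have := ge_sup S0 (ubS y py); rewrite ler_pdivlMr; lra.
Qed.

(** A discrete form of the integral comparison. With L = ln (k+2) - ln (k+1) it reduces to eta /
    (k+2) <= eta L <= exp (eta L) - 1. *)
Lemma powR_le_telescope {R : realType} (eta : R) (k : nat) : 0 < eta ->
  k.+2%:R `^ (- 1 - eta) <= eta^-1 * (k.+1%:R `^ (- eta) - k.+2%:R `^ (- eta)).
Proof.
move=> eta0; rewrite mulrC ler_pdivlMr//.
have k1 : 0 < k.+1%:R :> R by rewrite ltr0n.
have k2 : 0 < k.+2%:R :> R by rewrite ltr0n.
have k12 : k.+2%:R = k.+1%:R + 1 :> R by rewrite -(natr1 k.+1).
rewrite /powR !gt_eqF//.
have -> : expR ((- 1 - eta) * ln k.+2%:R) = expR (- eta * ln k.+2%:R) / k.+2%:R :> R.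
  have -> : k.+2%:R^-1 = expR (- ln k.+2%:R) :> R by rewrite expRN lnK.
  by rewrite -expRD; congr expR; ring.
have -> : expR (- eta * ln k.+1%:R) =
    expR (- eta * ln k.+2%:R) * expR (eta * (ln k.+2%:R - ln k.+1%:R)) :> R.
  by rewrite -expRD; congr expR; ring.
rewrite -mulrA -{3}(mulr1 (expR _)) -mulrBr ler_wpM2l ?expR_ge0//.
apply: (@le_trans _ _ (eta * (ln k.+2%:R - ln k.+1%:R))); last first.
  by have := expR_ge1Dx (eta * (ln k.+2%:R - ln k.+1%:R)); lra.
rewrite mulrC ler_wpM2l ?(ltW eta0)//.
have kE : k.+1%:R / k.+2%:R = 1 - k.+2%:R^-1 :> R.
  have -> : k.+1%:R = k.+2%:R - 1 :> R by rewrite k12 addrK.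
  by rewrite mulrBl divff ?gt_eqF// mul1r.
have kV : -1 < - k.+2%:R^-1 :> R by rewrite ltrN2 invf_lt1// ltr1n.
by have := le_ln1Dx kV; rewrite -kE ln_div ?posrE// -(opprB (ln _)) lerN2.
Qed.

Lemma is_cvg_series_powR {R : realType} (eta : R) : 0 < eta ->
  cvgn (series (fun k : nat => k.+1%:R `^ (- 1 - eta) : R)).
Proof.
move=> eta0; apply: nondecreasing_is_cvgn.
  by apply: nondecreasing_series => n _ _; exact: powR_ge0.
exists (1 + eta^-1) => _ [n _ <-].
apply: (@le_trans _ _ (1 + eta^-1 * (1 - n.+1%:R `^ (- eta)))); last first.
  have : 0 <= eta^-1 by rewrite invr_ge0 ltW.
  by have := @powR_ge0 R n.+1%:R (- eta); nra.
(* The subtracted power is what lets the induction telescope. *)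
have H m : series (fun k : nat => k.+1%:R `^ (- 1 - eta) : R) m.+1
    <= 1 + eta^-1 * (1 - m.+1%:R `^ (- eta)).
  elim: m => [|m IH].
    by rewrite /series/= big_nat1 !powR1 subrr mulr0 addr0.
  by rewrite seriesSr; have := powR_le_telescope _ m eta0; nra.
apply: le_trans (H n).
by rewrite seriesSr lerDl powR_ge0.
Qed.

(** Since [y] grows at least linearly, it exceeds [r0] from the index [m0] on. The majorant is
    [u + v]: the finitely many earlier terms themselves, plus a multiple of the convergent series of
    (m+1)^(-1-eta). *)
Lemma is_cvg_series_tempered {R : realType} (Phi : R -> R) (y : nat -> R) (d : R) :
  strongly_tempered Phi -> 0 < d -> (forall m : nat, d * m.+1%:R <= y m) ->
  cvgn (series (fun m => `|Phi (y m)|)).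
Proof.
move=> [r0 [C [eta [r00 C0 eta0 HPhi]]]] d0 Hy.
pose m0 := (Num.truncn (r0 / d)).+1.
pose K := C * d `^ (- 1 - eta).
pose u (m : nat) : R := if (m < m0)%N then `|Phi (y m)| else 0.
pose v (m : nat) : R := K * m.+1%:R `^ (- 1 - eta).
have v0 m : 0 <= v m by rewrite !mulr_ge0 ?powR_ge0// ltW.
have u0 m : 0 <= u m by rewrite /u; case: ifP.
apply: (@series_le_cvg _ _ (u + v)) => //=.
- by move=> n; exact: addr_ge0 (u0 n) (v0 n).
- move=> n; rewrite -[leRHS]/(u n + v n) /u; case: ltnP => [_|m0n].
    by rewrite lerDl.
  have dn : r0 < d * n.+1%:R.
    rewrite mulrC -ltr_pdivrMr//.
    have /andP[_ /lt_le_trans] : (Num.truncn (r0 / d))%:R <= r0 / d < m0%:R.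
      by apply: truncn_itv; rewrite divr_ge0 ?ltW.
    by apply; rewrite ler_nat ltnW.
  have yn := lt_le_trans dn (Hy n).
  rewrite add0r; apply: le_trans (ltW (HPhi _ yn)) _.
  rewrite /v /K -mulrA ler_wpM2l ?(ltW C0)// -powRM ?(ltW d0)//.
  (* Written with a negated positive exponent, the power is the inverse of an increasing one, so
     [d * n.+1%:R <= y n] gives the bound. *)
  have -> : - 1 - eta = - (1 + eta) by ring.
  have yn0 := lt_trans r00 yn.
  rewrite !powRN lef_pV2 ?posrE ?powR_gt0// ?(lt_trans r00 dn)//.
  by apply: ge0_ler_powR; rewrite ?nnegrE// ?ltW ?addr_gt0// (lt_trans r00 dn).
- apply: is_cvg_seriesD; last exact/is_cvg_seriesZ/is_cvg_series_powR.
  rewrite -(is_cvg_series_restrict m0).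
  have -> : (fun n => \sum_(m0 <= k < n) u k) = cst 0.
    apply/funext => n; rewrite big_nat big1// => i /andP[m0i _].
    by rewrite /u ltnNge m0i.
  exact: is_cvg_cst.
Qed.

(** * Periodic sums and sums over the integers *)

Lemma periodic_addz {T : Type} (g : int -> T) (N : nat) (k q : int) :
  (forall k, g (k + N%:Z) = g k) -> g (k + q * N%:Z) = g k.
Proof.
move=> gN; elim: q k => [|q IH|q IH] k.
- by rewrite mul0r addr0.
- by rewrite -[in RHS](IH k) -[in RHS]gN; congr g; lia.
- by rewrite -[in LHS]gN -[in RHS](IH k); congr g; lia.
Qed.

Lemma periodic_forall {T : Type} (g : int -> T) (N : nat) (P : T -> Prop) :
  (0 < N)%N -> (forall k, g (k + N%:Z) = g k) ->
  (forall i : nat, (i < N)%N -> P (g i%:Z)) -> forall k, P (g k).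
Proof.
move=> N0 gN H k; rewrite (divz_eq k N%:Z) addrC periodic_addz//.
have NZ : N%:Z != 0 by lia.
have := modz_ge0 k NZ; have := ltz_mod k NZ.
case: (k %% N)%Z => // m mN _; apply: H; lia.
Qed.

(** A shift by one replaces the first term of a period by the term one period later, which is equal
    to it. *)
Lemma periodic_sum_shift {V : zmodType} (g : int -> V) (N j : nat) :
  (forall k, g (k + N%:Z) = g k) ->
  \sum_(i < N) g (i%:Z + j%:Z) = \sum_(i < N) g i%:Z.
Proof.
move=> gN; elim: j => [|j <-].
  by apply: eq_bigr => i _; rewrite addr0.
case: N gN => [|N] gN; first by rewrite !big_ord0.
rewrite big_ord_recr [RHS]big_ord_recl [LHS]addrC; congr (_ + _).
  by rewrite /= -[RHS]gN; congr g; lia.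
by apply: eq_bigr => i _; congr g; rewrite lift0 /=; lia.
Qed.

Lemma cvg_sum_ord {R : realType} (N : nat) (u : 'I_N -> nat -> R) (l : 'I_N -> R) :
  (forall i, u i @ \oo --> l i) ->
  (fun n => \sum_(i < N) u i n) @ \oo --> \sum_(i < N) l i.
Proof.
by move=> ul; apply: cvg_big => //; exact: add_continuous.
Qed.

Lemma cvg_series_behead {R : realType} (u : nat -> R) (l : R) :
  series (fun j => u j.+1) @ \oo --> l -> series u @ \oo --> u 0%N + l.
Proof.
move=> ul; rewrite -cvg_shiftS.
have -> : [sequence series u n.+1]_n = (fun n => u 0%N + series (fun j => u j.+1) n).
  by apply/funext => n; rewrite /series/= big_nat_recl.
by apply: cvgD => //; exact: cvg_cst.
Qed.

Lemma cvg_series_behead_inv {R : realType} (u : nat -> R) (l : R) :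
  series u @ \oo --> l -> series (fun j => u j.+1) @ \oo --> l - u 0%N.
Proof.
rewrite -cvg_shiftS => ul.
have -> : series (fun j => u j.+1) = (fun n => series u n.+1 - u 0%N).
  by apply/funext => n; rewrite /series/= big_nat_recl// addrAC subrr add0r.
by apply: cvgB => //; exact: cvg_cst.
Qed.

(** [sumZ] cuts the integers at 0, whereas the interactions of particle [n] are cut at [n]. Lowering
    the cut by one moves a single term from the left series to the right one. *)
Lemma sumZ_center {R : realType} (g : int -> R) (n : nat) (u v : R) :
  series (fun j : nat => g (n%:Z + j%:Z)) @ \oo --> u ->
  series (fun j : nat => g (n%:Z - j.+1%:Z)) @ \oo --> v ->
  sumZ g = u + v.
Proof.
elim: n u v => [|n IH] u v gu gv.
  congr (_ + _); apply: cvg_lim => //.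
  rewrite (_ : (fun j => g (Negz j)) = (fun j => g (0%N%:Z - j.+1%:Z)))//.
  by apply/funext => j; congr g; lia.
rewrite (IH (g n%:Z + u) (v - g n%:Z)); first by ring.
- have := cvg_series_behead (fun j => g (n%:Z + j%:Z)) u.
  rewrite /= addr0; apply.
  rewrite (_ : (fun j => g (n%:Z + j.+1%:Z)) = (fun j => g (n.+1%:Z + j%:Z))).
    exact: gu.
  by apply/funext => j; congr g; lia.
- have := cvg_series_behead_inv _ _ gv.
  rewrite (_ : n.+1%:Z - 1%N%:Z = n%:Z); last lia.
  by rewrite (_ : (fun j => g (n.+1%:Z - j.+2%:Z)) = (fun j => g (n%:Z - j.+1%:Z)))//.
Qed.

Lemma species_ofD_even (n k : int) : ~~ odd `|k|%N -> species_of (n + k) = species_of n.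
Proof.
move=> k2; rewrite /species_of; have -> : odd `|(n + k)%R|%N = odd `|n|%N by lia.
by [].
Qed.

Lemma species_ofD_odd (n k : int) : odd `|k|%N ->
  species_of (n + k) = if species_of n is Sp1 then Sp2 else Sp1.
Proof.
move=> k1; rewrite /species_of; have -> : odd `|(n + k)%R|%N = ~~ odd `|n|%N by lia.
by case: odd.
Qed.

(** * Jensen's inequality along a periodic configuration *)

Definition gap {R : realType} (x : int -> R) (k : int) : R := x (k + 1) - x k.

Lemma sum_gap {R : realType} (x : int -> R) (k : int) (m : nat) :
  x (k + m%:Z) - x k = \sum_(j < m) gap x (k + j%:Z).
Proof.
elim: m => [|m IH]; first by rewrite addr0 subrr big_ord0.
rewrite big_ord_recr /= -IH /gap (_ : k + m%:Z + 1 = k + m.+1%:Z); last lia.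
by ring.
Qed.

(** The points [k%:R * a j] have mean [\sum_(j < k) a j], so the linear terms of the supporting line
    there cancel. *)
Lemma jensen_sum {R : realType} (Phi : R -> R) (k : nat) (a : 'I_k -> R) :
  convex_function (`]0, +oo[%classic : set R) Phi -> (0 < k)%N ->
  (forall j, 0 < a j) ->
  Phi (\sum_(j < k) a j) <= k%:R^-1 * \sum_(j < k) Phi (k%:R * a j).
Proof.
move=> cPhi k0 a0; have kR : 0 < k%:R :> R by rewrite ltr0n.
have p0 : 0 < \sum_(j < k) a j.
  case: k k0 a a0 {kR} => // k _ a a0.
  by rewrite big_ord_recl ltr_wpDr// sumr_ge0// => i _; exact: ltW.
set p := \sum_(j < k) a j in p0 *.
have [s Hs] := convex_supporting_line _ _ cPhi p0.
rewrite mulrC ler_pdivlMr//.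
apply: (@le_trans _ _ (\sum_(j < k) (Phi p + s * (k%:R * a j - p)))).
  rewrite big_split /= -mulr_sumr sumrB -mulr_sumr -/p !sumr_const card_ord.
  by rewrite mulr_natl mulr_natr subrr mulr0 addr0.
by apply: ler_sum => j _; apply: Hs; rewrite mulr_gt0.
Qed.

Section configuration.
Context {R : realType} {rho : R} {N : nat} {x : int -> R}.
Hypotheses (N0 : (0 < N)%N) (rho0 : 0 < rho) (Px : periodic_conf rho N x).

Lemma gap_gt0 k : 0 < gap x k.
Proof. by case: Px => _ + _; rewrite /gap subr_gt0; apply. Qed.

Lemma gapDN k : gap x (k + N%:Z) = gap x k.
Proof.
case: Px => _ _ xN; rewrite /gap -addrA [N%:Z + 1]addrC addrA !xN.
by ring.
Qed.

Lemma difference_gt0 k m : (0 < m)%N -> 0 < x (k + m%:Z) - x k.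
Proof.
case: m => // m _; rewrite sum_gap big_ord_recl ltr_wpDr ?gap_gt0// sumr_ge0// => i _.
exact/ltW/gap_gt0.
Qed.

Lemma differenceDN k m : x (k + N%:Z + m%:Z) - x (k + N%:Z) = x (k + m%:Z) - x k.
Proof.
by case: Px => _ _ xN; rewrite addrAC !xN; ring.
Qed.

Lemma sum_gap_period : \sum_(n < N) gap x n%:Z = N%:R / rho.
Proof.
have := sum_gap x 0 N; case: Px => x0 _ xN.
rewrite xN x0 add0r subr0 mulrC => ->.
by apply: eq_bigr => n _; rewrite add0r.
Qed.

(** By periodicity there are only finitely many distinct gaps. The bound makes distances grow
    linearly in the index, which is what convergence of the interaction series is drawn from. *)
Lemma gap_lower_bound : exists2 d, 0 < d & forall k, d <= gap x k.
Proof.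
have [d d0 Hd] : exists2 d, 0 < d & forall i, (i < N)%N -> d <= gap x i%:Z.
  elim: (N) => [|n [d d0 Hd]]; first by exists 1.
  exists (Num.min d (gap x n%:Z)); first by rewrite lt_min d0 gap_gt0.
  move=> i; rewrite ltnS leq_eqVlt => /orP[/eqP ->|/Hd].
    by rewrite ge_min lexx orbT.
  by rewrite ge_min => ->.
exists d => //; exact: (periodic_forall (gap x) N (fun y => d <= y) N0 gapDN Hd).
Qed.

(** Double counting: the term [G n] lies in the [k] windows that start at n, n-1, ..., n-k+1, whose
    weights add up to [c * k%:R]. *)
Lemma weighted_window_sum (w G : int -> R) (c : R) (k : nat) :
  (forall n, w (n + N%:Z) = w n) -> (forall n, G (n + N%:Z) = G n) ->
  (forall n, \sum_(j < k) w (n - j%:Z) = c * k%:R) ->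
  \sum_(n < N) w n%:Z * \sum_(j < k) G (n%:Z + j%:Z) =
  c * k%:R * \sum_(n < N) G n%:Z.
Proof.
move=> wN GN wk.
under eq_bigr do rewrite mulr_sumr.
rewrite exchange_big /= mulr_sumr.
under [RHS]eq_bigr => n _ do rewrite -(wk n%:Z) mulr_suml.
rewrite [RHS]exchange_big /=; apply: eq_bigr => j _.
rewrite -(@periodic_sum_shift _ (fun n => w (n - j%:Z) * G n) N j).
  by apply: eq_bigr => n _; rewrite addrK.
by move=> n; rewrite GN addrAC wN.
Qed.

(* Odd k uses w = 1 and c = 1; even k uses the indicator of a species, for which
   c = 1/2. *)
Section weighted_jensen.
Variables (w : int -> R) (c : R) (k : nat) (Phi : R -> R).
Hypotheses (w0 : forall n, 0 <= w n) (wN : forall n, w (n + N%:Z) = w n).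
Hypotheses (k0 : (0 < k)%N) (wk : forall n, \sum_(j < k) w (n - j%:Z) = c * k%:R).
Hypothesis cPhi : convex_function (`]0, +oo[%classic : set R) Phi.

Let kR : 0 < k%:R :> R. Proof. by rewrite ltr0n. Qed.

(** This is the double count with the constant [G = 1], divided by [k]. *)
Lemma sum_weights : \sum_(n < N) w n%:Z = c * N%:R.
Proof.
have := @weighted_window_sum w (fun=> 1) c k wN (fun=> erefl) wk.
rewrite -mulr_suml !sumr_const !card_ord => H.
by apply: (mulIf (lt0r_neq0 kR)); rewrite H; ring.
Qed.

(** The double count with [G = gap x] shows that the weighted mean of the k-th neighbour distances
    is k / rho. *)
Lemma sum_weighted_deviation :
  \sum_(n < N) w n%:Z * (x (n%:Z + k%:Z) - x n%:Z - k%:R / rho) = 0.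
Proof.
under eq_bigr do rewrite mulrBr sum_gap.
rewrite sumrB (weighted_window_sum _ _ _ _ wN gapDN wk) sum_gap_period.
by rewrite -mulr_suml sum_weights; ring.
Qed.

Lemma jensen_below :
  0 <= \sum_(n < N) w n%:Z * (Phi (x (n%:Z + k%:Z) - x n%:Z) - Phi (k%:R / rho)).
Proof.
have p0 : 0 < k%:R / rho by rewrite divr_gt0.
have [s Hs] := convex_supporting_line _ _ cPhi p0.
(* Zero is rewritten as [s] times the vanishing weighted deviation, so that the supporting line at k
   / rho can be compared term by term. *)
rewrite -[leLHS](mulr0 s) -[X in s * X]sum_weighted_deviation mulr_sumr.
apply: ler_sum => n _.
rewrite mulrCA ler_wpM2l//; have := Hs _ (difference_gt0 n%:Z k k0); lra.
Qed.

(** [jensen_sum] bounds each window by the mean of [Phi] at [k] times its gaps; double counting then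
    leaves the factor k^-1 * c * k = c. *)
Lemma jensen_above :
  \sum_(n < N) w n%:Z * (Phi (x (n%:Z + k%:Z) - x n%:Z) - Phi (k%:R / rho)) <=
  c * \sum_(n < N) (Phi (k%:R * gap x n%:Z) - Phi (k%:R / rho)).
Proof.
under eq_bigr do rewrite mulrBr.
rewrite !sumrB -mulr_suml sum_weights mulrBr sumr_const card_ord.
rewrite -[Phi _ *+ N]mulr_natl [c * (_ * _)]mulrA lerB//.
pose G n := Phi (k%:R * gap x n).
have := @weighted_window_sum w G c k wN _ wk.
rewrite /G => /(_ (fun n => congr1 (fun y => Phi (k%:R * y)) (gapDN n))) H.
apply: (@le_trans _ _ (k%:R^-1 * (c * k%:R * \sum_(n < N) G n%:Z))); last first.
  by rewrite mulrCA !mulrA -[c * _ * _]mulrA divff ?mulr1// gt_eqF.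
rewrite -H mulr_sumr; apply: ler_sum => n _.
rewrite mulrCA ler_wpM2l// sum_gap; apply: jensen_sum => // j.
exact: gap_gt0.
Qed.

End weighted_jensen.

Lemma jensen_below_unweighted (Phi : R -> R) (k : nat) :
  (0 < k)%N -> convex_function (`]0, +oo[%classic : set R) Phi ->
  0 <= \sum_(n < N) (Phi (x (n%:Z + k%:Z) - x n%:Z) - Phi (k%:R / rho)).
Proof.
move=> k0 cPhi; have wk (n : int) : \sum_(j < k) 1 = 1 * k%:R :> R.
  by rewrite sumr_const card_ord mul1r.
have := jensen_below (fun=> 1) 1 k Phi (fun=> ler01) (fun=> erefl) k0 wk cPhi.
by under eq_bigr do rewrite mul1r.
Qed.

(** The deficits over the supporting line at k / rho are nonnegative and their sum is at most 0, so
    each vanishes: [Phi] touches the line at every k-th neighbour distance. *)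
Lemma strict_jensen_eq (Phi : R -> R) (k : nat) :
  (0 < k)%N ->
  convex_function (`]0, +oo[%classic : set R) Phi ->
  strictly_convex_function (`]0, +oo[%classic : set R) Phi ->
  \sum_(n < N) (Phi (x (n%:Z + k%:Z) - x n%:Z) - Phi (k%:R / rho)) <= 0 ->
  forall n, x (n + k%:Z) - x n = k%:R / rho.
Proof.
move=> k0 cPhi sPhi Hle.
apply: (periodic_forall (fun n => x (n + k%:Z) - x n) _ (fun y => y = k%:R / rho) N0).
  by move=> n; exact: differenceDN.
have kR : 0 < k%:R :> R by rewrite ltr0n.
have p0 : 0 < k%:R / rho by rewrite divr_gt0.
have [s Hs] := convex_supporting_line _ _ cPhi p0.
have dev : \sum_(n < N) (x (n%:Z + k%:Z) - x n%:Z - k%:R / rho) = 0.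
  have wk (n : int) : \sum_(j < k) 1 = 1 * k%:R :> R.
    by rewrite sumr_const card_ord mul1r.
  have := sum_weighted_deviation (fun=> 1) 1 k (fun=> erefl) k0 wk.
  by under eq_bigr do rewrite mul1r.
set p := k%:R / rho in p0 Hs dev Hle *.
pose e (n : 'I_N) := Phi (x (n%:Z + k%:Z) - x n%:Z) - Phi p - s * (x (n%:Z + k%:Z) - x n%:Z - p).
have e0 n : 0 <= e n.
  by rewrite /e; have := Hs _ (difference_gt0 n%:Z k k0); lra.
have se : \sum_n e n = 0.
  apply/eqP; rewrite eq_le sumr_ge0 ?andbT//.
  by rewrite sumrB -mulr_sumr dev mulr0 subr0.
move=> i iN; apply/eqP/negPn/negP => ne.
have : e (Ordinal iN) = 0.
  by apply/eqP; move: se => /eqP; rewrite psumr_eq0// => /allP; apply; rewrite mem_index_enum.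
rewrite /e /=; set y := x (i%:Z + k%:Z) - x i%:Z in ne *.
have y0 : 0 < y by exact: difference_gt0.
move=> ey.
(* If [y] differed from [p], [Phi] would meet the line at both points, and strict convexity would
   put it below the line at their midpoint. *)
have half : 0 < (2^-1 : R) < 1 by lra.
have Dy : `]0, +oo[%classic y by rewrite /= in_itv/= y0.
have Dp : `]0, +oo[%classic p by rewrite /= in_itv/= p0.
have m0 : 0 < 2^-1 * y + (1 - 2^-1) * p by lra.
have := sPhi _ _ _ half Dy Dp ne; have := Hs _ m0.
have -> : s * (2^-1 * y + (1 - 2^-1) * p - p) = 2^-1 * (s * (y - p)) by ring.
set m := Phi (_ + _); set sy := s * _ in ey *; lra.
Qed.

End configuration.

(** * The energy as a sum over neighbour shells *)

(** Only right neighbours are counted, so a pair at index distance [k] appears once per period,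
    while the energy sees it from both of its ends. *)
Definition shell {R : realType} (f : species -> species -> R -> R) (N : nat)
    (x : int -> R) (k : nat) : R :=
  \sum_(n < N) f (species_of n%:Z) (species_of (n%:Z + k%:Z))
                 (x (n%:Z + k%:Z) - x n%:Z).

Lemma periodic_equidistant {R : realType} (rho : R) (N : nat) :
  0 < rho -> periodic_conf rho N (equidistant rho).
Proof.
move=> rho0; rewrite /equidistant; split => [|k|k].
- by rewrite mul0r.
- by rewrite ltr_pM2r ?invr_gt0// ltr_int; lia.
- by rewrite intrD mulrDl; congr (_ + _); rewrite mulrC.
Qed.

Lemma equidistant_difference {R : realType} (rho : R) (n : int) (k : nat) :
  equidistant rho (n + k%:Z) - equidistant rho n = k%:R / rho.
Proof. by rewrite /equidistant intrD mulrDl addrAC subrr add0r. Qed.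

Section energy_series.
Context {R : realType} {f Phip Phim : species -> species -> R -> R}.
Hypotheses (f_mirror : forall (a b : species) (x : R), f a b (- x) = f a b x)
  (f_sym : forall x : R, f Sp2 Sp1 x = f Sp1 Sp2 x)
  (f_decomp : forall (a b : species) (x : R),
     f a b x = Phip a b `|x| - Phim a b `|x|)
  (Phip_tempered : forall a b : species, strongly_tempered (Phip a b))
  (Phim_tempered : forall a b : species, strongly_tempered (Phim a b)).

(** The species [s m] varies along the series, so the majorant adds the bounds for both species. *)
Lemma is_cvg_series_interaction (a : species) (s : nat -> species)
    (y : nat -> R) (d : R) :
  0 < d -> (forall m, d * m.+1%:R <= `|y m|) ->
  cvgn (series (fun m => f a (s m) (y m))).
Proof.
move=> d0 Hy; apply: normed_cvg.
pose u b m := `|Phip a b `|y m| | + `|Phim a b `|y m| |.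
have u0 b m : 0 <= u b m by rewrite addr_ge0.
have ucv b : cvgn (series (u b)).
  by apply: is_cvg_seriesD; apply: is_cvg_series_tempered d0 Hy.
apply: (@series_le_cvg _ _ (u Sp1 + u Sp2)) => /=.
- by [].
- by move=> m; exact: addr_ge0 (u0 _ m) (u0 _ m).
- move=> m; rewrite -[leRHS]/(u Sp1 m + u Sp2 m) f_decomp.
  apply: (@le_trans _ _ (u (s m) m)); first exact: ler_normB.
  by case: (s m); rewrite ?lerDl ?lerDr.
- by apply: is_cvg_seriesD; exact: ucv.
Qed.

Lemma f_exchange (a b : species) (x y : R) : f a b (x - y) = f b a (y - x).
Proof.
by rewrite -opprB f_mirror; case: a; case: b.
Qed.

Context {rho : R} {N : nat} {x : int -> R}.
Hypotheses (N0 : (0 < N)%N) (N2 : ~~ odd N) (Px : periodic_conf rho N x).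

Lemma difference_lower_bound : exists2 d, 0 < d &
  forall k (m : nat), d * m%:R <= x (k + m%:Z) - x k.
Proof.
have [d d0 Hd] := gap_lower_bound N0 Px; exists d => // k m.
rewrite sum_gap mulr_natr -[in leLHS](card_ord m) -sumr_const.
by apply: ler_sum => j _; exact: Hd.
Qed.

Let A (n : int) (m : nat) : R :=
  f (species_of n) (species_of (n + m.+1%:Z)) (x (n + m.+1%:Z) - x n).
Let B (n : int) (m : nat) : R :=
  f (species_of n) (species_of (n - m.+1%:Z)) (x (n - m.+1%:Z) - x n).

Let cvgA n : cvgn (series (A n)).
Proof.
have [d d0 Hd] := difference_lower_bound.
apply: (is_cvg_series_interaction _ _ _ d d0) => m.
exact: le_trans (Hd n m.+1) (ler_norm _).
Qed.

Let cvgB n : cvgn (series (B n)).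
Proof.
have [d d0 Hd] := difference_lower_bound.
apply: (is_cvg_series_interaction _ _ _ d d0) => m.
rewrite distrC; apply: le_trans (ler_norm _).
by have := Hd (n - m.+1%:Z) m.+1; rewrite subrK.
Qed.

(** Evenness of [N] makes the species [N]-periodic, and with them the interactions. *)
Let AN n m : A (n + N%:Z) m = A n m.
Proof.
rewrite /A addrAC !(species_ofD_even _ N%:Z)// -[n + m.+1%:Z + _]addrAC.
by rewrite (differenceDN Px).
Qed.

Let BN n m : B (n + N%:Z) m = B n m.
Proof.
rewrite /B addrAC !(species_ofD_even _ N%:Z)//.
by case: Px => _ _ xN; rewrite !xN; congr (f _ _ _); ring.
Qed.

Let sumA m : \sum_(i < N) A i.+1%:Z m = shell f N x m.+1.
Proof.
transitivity (\sum_(i < N) A (i%:Z + 1%N%:Z) m).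
  by apply: eq_bigr => i _; congr A; lia.
exact: (periodic_sum_shift (A^~ m) N 1 (AN^~ m)).
Qed.

(** After a shift of the base particle by m+1, its left neighbour is particle i, and [f_exchange]
    reads the same pair from the other end. *)
Let sumB m : \sum_(i < N) B i.+1%:Z m = shell f N x m.+1.
Proof.
transitivity (\sum_(i < N) B (i%:Z + 1%N%:Z) m).
  by apply: eq_bigr => i _; congr B; lia.
rewrite (periodic_sum_shift (B^~ m) N 1 (BN^~ m)).
rewrite -(periodic_sum_shift (B^~ m) N m.+1 (BN^~ m)).
by apply: eq_bigr => i _; rewrite /B addrK f_exchange.
Qed.

Let sumZAB (n : nat) :
  sumZ (fun k : int => if k == n%:Z then 0
    else f (species_of n%:Z) (species_of k) (x k - x n%:Z)) =
  limn (series (A n%:Z)) + limn (series (B n%:Z)).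
Proof.
set g := fun k : int => _.
have gA : (fun j => g (n%:Z + j.+1%:Z)) = A n%:Z.
  by apply/funext => j; rewrite /g ifF//; lia.
have gB : (fun j => g (n%:Z - j.+1%:Z)) = B n%:Z.
  by apply/funext => j; rewrite /g ifF//; lia.
apply: (@sumZ_center _ g n); last by rewrite gB; exact: cvgB.
(* The excluded index k = n is the first term of the right series and contributes 0. *)
rewrite -[limn _]add0r; have {1}-> : 0 = g (n%:Z + 0%N%:Z).
  by rewrite /g addr0 eqxx.
by apply: cvg_series_behead; rewrite gA; exact: cvgA.
Qed.

(** Summed over a period, the right and the left k-th neighbour interactions give the same shell;
    the factor N / 2 removes the normalisation and this double count. *)
Lemma cvg_energy :
  series (fun k => shell f N x k.+1) @ \oo --> N%:R / 2 * energy f N x.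
Proof.
have NR : N%:R != 0 :> R by rewrite pnatr_eq0 -lt0n.
rewrite /energy (_ : forall S : R, N%:R / 2 * (N%:R^-1 * S) = 2^-1 * S); last first.
  by move=> S; field.
rewrite big_add1 /= big_mkord.
under eq_bigr do rewrite sumZAB.
have AB : (fun M => \sum_(i < N) (series (A i.+1%:Z) M + series (B i.+1%:Z) M))
    @ \oo --> \sum_(i < N) (limn (series (A i.+1%:Z)) + limn (series (B i.+1%:Z))).
  by apply: cvg_sum_ord => i; apply: cvgD; [exact: cvgA|exact: cvgB].
rewrite (_ : series _ = fun M => 2^-1 *
    \sum_(i < N) (series (A i.+1%:Z) M + series (B i.+1%:Z) M)).
  by apply: cvgMr; exact: AB.
apply/funext => M; rewrite big_split /= [in X in X + _]exchange_big.
rewrite [in X in _ + X]exchange_big -big_split /= mulr_sumr.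
by apply: eq_bigr => m _; rewrite sumA sumB; field.
Qed.

End energy_series.

(** * Comparison with the equidistant configuration *)

Definition species_weight {R : realType} (a : species) (n : int) : R :=
  match a, species_of n with Sp1, Sp1 | Sp2, Sp2 => 1 | _, _ => 0 end.

Lemma species_weight_ge0 {R : realType} a n : 0 <= species_weight a n :> R.
Proof. by rewrite /species_weight; case: a; case: species_of. Qed.

(** Of two consecutive particles exactly one has species [a], so the induction peels off two indices
    at a time. *)
Lemma species_weight_window {R : realType} (a : species) (m : nat) (n : int) :
  \sum_(j < (2 * m)%N) species_weight a (n - j%:Z) = 2^-1 * (2 * m)%:R :> R.
Proof.
elim: m n => [|m IH] n; first by rewrite big_ord0 mulr0.
rewrite mulnS 2!big_ord_recl natrD mulrDr -(IH (n - 2%:Z)) addrA; congr (_ + _).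
  rewrite mulVf// /= subr0 /species_weight /species_of /bump /=.
  have -> : odd `|(n - (1 + 0)%N%:Z)%R|%N = ~~ odd `|n|%N by lia.
  by case: a {IH}; case: odd => /=; ring.
by apply: eq_bigr => j _; congr species_weight; rewrite /= /bump /=; lia.
Qed.

Lemma species_weight_split {R : realType} (h : species -> R) (n : int) :
  h (species_of n) = species_weight Sp1 n * h Sp1 + species_weight Sp2 n * h Sp2.
Proof. by rewrite /species_weight; case: species_of; ring. Qed.

Section comparison.
Context {R : realType} {f Phip Phim : species -> species -> R -> R}.
Hypotheses (f_sym : forall x : R, f Sp2 Sp1 x = f Sp1 Sp2 x)
  (f_decomp : forall (a b : species) (x : R),
     f a b x = Phip a b `|x| - Phim a b `|x|)
  (Phip_convex : forall a b : species,
     convex_function (`]0, +oo[%classic : set R) (Phip a b))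
  (Phim_convex : forall a b : species,
     convex_function (`]0, +oo[%classic : set R) (Phim a b)).

Let f_pos a b y : 0 < y -> f a b y = Phip a b y - Phim a b y.
Proof. by move=> y0; rewrite f_decomp gtr0_norm. Qed.

Context {rho : R} {N : nat} {x : int -> R}.
Hypotheses (N2 : ~~ odd N) (rho0 : 0 < rho)
  (Px : periodic_conf rho N x).

Let dist (n : int) (k : nat) : R := x (n + k%:Z) - x n.

(** For odd [k] all pairs are mixed, so only the 12 interaction occurs and the weights are 1. The
    deficit of Phi_12^+ is kept: it enters F for k = 1 and yields uniqueness for k = 3 and k = 5. *)
Lemma shell_odd_below (k : nat) : odd k ->
  \sum_(n < N) (Phip Sp1 Sp2 (x (n%:Z + k%:Z) - x n%:Z) - Phip Sp1 Sp2 (k%:R / rho))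
  - \sum_(n < N) (Phim Sp1 Sp2 (k%:R * gap x n%:Z) - Phim Sp1 Sp2 (k%:R / rho))
  <= shell f N x k - shell f N (equidistant rho) k.
Proof.
move=> k1; have k0 : (0 < k)%N by case: k k1.
have p0 : 0 < k%:R / rho by rewrite divr_gt0 ?ltr0n.
have f12 n y : f (species_of n) (species_of (n + k%:Z)) y = f Sp1 Sp2 y.
  by rewrite species_ofD_odd//; case: species_of.
have wk (n : int) : \sum_(j < k) 1 = 1 * k%:R :> R.
  by rewrite sumr_const card_ord mul1r.
have := jensen_above Px (fun=> 1) 1 k (Phim Sp1 Sp2) (fun=> ler01) (fun=> erefl) k0 wk
  (Phim_convex Sp1 Sp2).
under eq_bigr do rewrite mul1r.
rewrite mul1r => H; apply: le_trans (lerB (lexx _) H) _.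
rewrite -!sumrB le_eqVlt; apply/predU1P; left; apply: eq_bigr => n _.
rewrite !f12 equidistant_difference !f_pos//; last exact: difference_gt0 Px _ _ k0.
by ring.
Qed.

(** For even [k] the particles of a pair share their species. The shell splits by species, each with
    indicator weights and c = 1/2; the nonnegative Phi^+ deficits are dropped. *)
Lemma shell_even_below (m k : nat) : k = (2 * m.+1)%N ->
  - (2^-1 * \sum_(n < N) (Phim Sp1 Sp1 (k%:R * gap x n%:Z) - Phim Sp1 Sp1 (k%:R / rho)
     + (Phim Sp2 Sp2 (k%:R * gap x n%:Z) - Phim Sp2 Sp2 (k%:R / rho))))
  <= shell f N x k - shell f N (equidistant rho) k.
Proof.
move=> kE; have k0 : (0 < k)%N by rewrite kE.
have p0 : 0 < k%:R / rho by rewrite divr_gt0 ?ltr0n.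
have wN a (n : int) : species_weight a (n + N%:Z) = species_weight a n :> R.
  by rewrite /species_weight species_ofD_even.
have wk a (n : int) : \sum_(j < k) species_weight a (n - j%:Z) = 2^-1 * k%:R :> R.
  by rewrite kE; exact: species_weight_window.
have below a : 0 <= \sum_(n < N) species_weight a n%:Z *
    (Phip a a (dist n%:Z k) - Phip a a (k%:R / rho)).
  exact: (jensen_below rho0 Px (species_weight a) _ k (Phip a a)
    (species_weight_ge0 a) (wN a) k0 (wk a)).
have above a := jensen_above Px (species_weight a) _ k (Phim a a)
  (species_weight_ge0 a) (wN a) k0 (wk a) (Phim_convex a a).
have -> : shell f N x k - shell f N (equidistant rho) k =
  \sum_(n < N) species_weight Sp1 n%:Z *
    (Phip Sp1 Sp1 (dist n%:Z k) - Phip Sp1 Sp1 (k%:R / rho))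
  - \sum_(n < N) species_weight Sp1 n%:Z *
    (Phim Sp1 Sp1 (dist n%:Z k) - Phim Sp1 Sp1 (k%:R / rho))
  + (\sum_(n < N) species_weight Sp2 n%:Z *
    (Phip Sp2 Sp2 (dist n%:Z k) - Phip Sp2 Sp2 (k%:R / rho))
  - \sum_(n < N) species_weight Sp2 n%:Z *
    (Phim Sp2 Sp2 (dist n%:Z k) - Phim Sp2 Sp2 (k%:R / rho))).
  rewrite -!sumrB -big_split /=; apply: eq_bigr => n _.
  rewrite species_ofD_even; last by rewrite kE mul2n odd_double.
  rewrite equidistant_difference !f_pos//; last exact: difference_gt0 Px _ _ k0.
  rewrite -/(dist n%:Z k) (species_weight_split (fun a =>
    Phip a a (dist n%:Z k) - Phim a a (dist n%:Z k) -
    (Phip a a (k%:R / rho) - Phim a a (k%:R / rho)))).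
  by rewrite /species_weight; ring.
rewrite big_split /= mulrDr.
have := below Sp1; have := below Sp2; have := above Sp1; have := above Sp2.
rewrite /dist.
set a1 := \sum_(n < N) _; set a2 := \sum_(n < N) _; set a3 := \sum_(n < N) _.
set a4 := \sum_(n < N) _; set a5 := \sum_(n < N) _; set a6 := \sum_(n < N) _.
lra.
Qed.

End comparison.

(** * Minimality and uniqueness of the equidistant configuration *)

Section minimality.
Context {R : realType} {f Phip Phim : species -> species -> R -> R}.
Hypotheses (f_mirror : forall (a b : species) (x : R), f a b (- x) = f a b x)
  (f_sym : forall x : R, f Sp2 Sp1 x = f Sp1 Sp2 x)
  (f_decomp : forall (a b : species) (x : R),
     f a b x = Phip a b `|x| - Phim a b `|x|)
  (Phip_convex : forall a b : species,
     convex_function (`]0, +oo[%classic : set R) (Phip a b))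
  (Phim_convex : forall a b : species,
     convex_function (`]0, +oo[%classic : set R) (Phim a b))
  (Phip_tempered : forall a b : species, strongly_tempered (Phip a b))
  (Phim_tempered : forall a b : species, strongly_tempered (Phim a b))
  (F_convex : convex_function (`]0, +oo[%classic : set R)
     (nn_potential Phip Phim)).
Context {rho : R} {N : nat} {x : int -> R}.
Hypotheses (N0 : (0 < N)%N) (N2 : ~~ odd N) (rho0 : 0 < rho)
  (Px : periodic_conf rho N x).

(** The m-th term of the series in F; it collects the Phi^- contributions of the shells 2m+1 and
    2m+2. *)
Let psi (m : nat) (r : R) : R :=
  2 * Phim Sp1 Sp2 ((2 * m.+1 - 1)%N%:R * r)
  + Phim Sp2 Sp2 ((2 * m.+1)%N%:R * r)
  + Phim Sp1 Sp1 ((2 * m.+1)%N%:R * r).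

Let D (k : nat) : R :=
  \sum_(n < N) (Phip Sp1 Sp2 (x (n%:Z + k%:Z) - x n%:Z) - Phip Sp1 Sp2 (k%:R / rho)).

Let excess (k : nat) : R := shell f N x k - shell f N (equidistant rho) k.

Let D_ge0 k : (0 < k)%N -> 0 <= D k.
Proof. by move=> k0; exact: jensen_below_unweighted rho0 Px _ _ k0 (Phip_convex _ _). Qed.

Let cvg_psi (r : R) : 0 < r -> series (psi^~ r) @ \oo --> limn (series (psi^~ r)).
Proof.
move=> r0.
have cv a b (k : nat -> nat) : (forall m, m < k m)%N ->
    cvgn (series (fun m => Phim a b ((k m)%:R * r))).
  move=> mk; apply: normed_cvg.
  apply: (is_cvg_series_tempered _ _ r (Phim_tempered a b) r0) => m.
  by rewrite mulrC ler_pM2r// ler_nat mk.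
have c1 := cv Sp1 Sp2 (fun m => 2 * m.+1 - 1)%N ltac:(move=> m; lia).
have c2 := cv Sp2 Sp2 (fun m => 2 * m.+1)%N ltac:(move=> m; lia).
have c3 := cv Sp1 Sp1 (fun m => 2 * m.+1)%N ltac:(move=> m; lia).
exact: is_cvg_seriesD (is_cvg_seriesD (is_cvg_seriesZ c1) c2) c3.
Qed.

(** An odd and the following even shell together match one term of the series in F: their weights 1
    and 1/2 are half the coefficients 2, 1, 1 in [psi]. *)
Let pair_below (m : nat) :
  D (2 * m).+1 <= excess (2 * m).+1 + excess (2 * m).+2 +
    2^-1 * \sum_(n < N) (psi m (gap x n%:Z) - psi m rho^-1).
Proof.
have k1 : odd (2 * m).+1 by lia.
have := shell_odd_below f_sym f_decomp Phim_convex rho0 Px _ k1.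
have k2 : (2 * m).+2 = (2 * m.+1)%N by lia.
have := shell_even_below f_decomp Phip_convex Phim_convex N2 rho0 Px _ _ k2.
rewrite -/(D _) -/(excess _) -/(excess _).
set e := \sum_(n < N) _; set o := \sum_(n < N) _.
have -> : \sum_(n < N) (psi m (gap x n%:Z) - psi m rho^-1) = 2 * o + e.
  rewrite mulr_sumr -big_split /=; apply: eq_bigr => n _.
  by rewrite /psi -k2 (_ : ((2 * m).+2 - 1 = (2 * m).+1)%N); [ring|lia].
lra.
Qed.

(** Jensen for F at k = 1 says that [D 1] is at least half the Phi^- sum over the gaps, so the two
    drop out of the limit of the summed [pair_below]. [D 3] and [D 5] remain for uniqueness. *)
Lemma energy_excess :
  D 3 + D 5 <= N%:R / 2 * energy f N x - N%:R / 2 * energy f N (equidistant rho).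
Proof.
have Pe := @periodic_equidistant _ rho N rho0.
(* Partial sums are taken at even lengths, since each [psi m] accounts for two shells. *)
have cvS : (fun M => series (fun k => excess k.+1) (2 * M)%N) @ \oo -->
    N%:R / 2 * energy f N x - N%:R / 2 * energy f N (equidistant rho).
  have cvE := cvgB
    (cvg_energy f_mirror f_sym f_decomp Phip_tempered Phim_tempered N0 N2 Px)
    (cvg_energy f_mirror f_sym f_decomp Phip_tempered Phim_tempered N0 N2 Pe).
  rewrite (_ : (fun M => series _ (2 * M)%N) = (fun M => series (fun k => shell f N x k.+1) M -
      series (fun k => shell f N (equidistant rho) k.+1) M) \o muln 2).
    by apply: cvg_comp (cvE _); exact: cvg_mulnl.
  by apply/funext => M; rewrite /= /series/= -sumrB.
have cvG : (fun M => \sum_(n < N) (series (psi^~ (gap x n%:Z)) M - series (psi^~ rho^-1) M))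
    @ \oo --> \sum_(n < N) (limn (series (psi^~ (gap x n%:Z))) - limn (series (psi^~ rho^-1))).
  apply: cvg_sum_ord => n; apply: cvgB; apply: cvg_psi; last by rewrite invr_gt0.
  exact: gap_gt0 Px _.
have cvL : (fun M => series (fun k => excess k.+1) (2 * M)%N + 2^-1 *
      \sum_(n < N) (series (psi^~ (gap x n%:Z)) M - series (psi^~ rho^-1) M)) @ \oo -->
    N%:R / 2 * energy f N x - N%:R / 2 * energy f N (equidistant rho) + 2^-1 *
      \sum_(n < N) (limn (series (psi^~ (gap x n%:Z))) - limn (series (psi^~ rho^-1))).
  by apply: cvgD cvS _; exact: cvgMr cvG.
(* Three pairs of shells bring in k = 1, 3 and 5; the remaining deficits are nonnegative and are
   dropped. *)
have below M : (3 <= M)%N -> D 1 + D 3 + D 5 <=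
    series (fun k => excess k.+1) (2 * M)%N + 2^-1 *
    \sum_(n < N) (series (psi^~ (gap x n%:Z)) M - series (psi^~ rho^-1) M).
  move=> M3.
  apply: (@le_trans _ _ (\sum_(0 <= m < M) D (2 * m).+1)).
    rewrite (big_cat_nat (leq0n 3) M3)//= !big_nat_recl// big_geq// addr0 addrA lerDl.
    by apply: sumr_ge0 => m _; exact: D_ge0.
  apply: (@le_trans _ _ (\sum_(0 <= m < M) (excess (2 * m).+1 + excess (2 * m).+2 +
    2^-1 * \sum_(n < N) (psi m (gap x n%:Z) - psi m rho^-1)))).
    by apply: ler_sum => m _; exact: pair_below.
  rewrite big_split /= -mulr_sumr exchange_big /= lerD//.
    elim: M {M3} => [|M IH]; first by rewrite /series/= !big_geq.
    rewrite big_nat_recr//= (_ : (2 * M.+1 = (2 * M).+2)%N); last lia.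
    by rewrite !seriesSr [leLHS]addrA 2!lerD2r; exact: IH.
  rewrite ler_wpM2l//; apply: ler_sum => n _.
  by rewrite sumrB.
have lim : D 1 + D 3 + D 5 <= N%:R / 2 * energy f N x - N%:R / 2 * energy f N (equidistant rho)
   + 2^-1 * \sum_(n < N) (limn (series (psi^~ (gap x n%:Z))) - limn (series (psi^~ rho^-1))).
  apply: (ler_cvg_to (cvg_cst (D 1 + D 3 + D 5)) cvL).
  by exists 3 => // M /= /below.
have nnE r : nn_potential Phip Phim r = 2 * Phip Sp1 Sp2 r - limn (series (psi^~ r)) by [].
have := jensen_below_unweighted rho0 Px _ 1 isT F_convex.
have -> : \sum_(n < N) (nn_potential Phip Phim (x (n%:Z + 1%N%:Z) - x n%:Z) -
    nn_potential Phip Phim (1%:R / rho)) = 2 * D 1 -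
    \sum_(n < N) (limn (series (psi^~ (gap x n%:Z))) - limn (series (psi^~ rho^-1))).
  rewrite /D mulr_sumr -sumrB; apply: eq_bigr => n _.
  rewrite !nnE mul1r -/(gap x n%:Z).
  set a := limn _; set b := limn _; ring.
move: lim; set d1 := D 1; set d3 := D 3; set d5 := D 5; set l := \sum_(n < N) _.
set e1 := N%:R / 2 * _; set e2 := N%:R / 2 * _; lra.
Qed.

Lemma equidistant_le : energy f N (equidistant rho) <= energy f N x.
Proof.
have NR : 0 < N%:R / 2 :> R by rewrite divr_gt0 ?ltr0n.
rewrite -(ler_pM2l NR) -subr_ge0; apply: le_trans energy_excess.
by rewrite addr_ge0 ?D_ge0.
Qed.

(* Strict convexity forces all third-neighbour and all fifth-neighbour distances
   to be constant, hence also all sixth-neighbour ones; the difference of the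
   last two is the gap. *)
Lemma equidistant_unique :
  strictly_convex_function (`]0, +oo[%classic : set R) (Phip Sp1 Sp2) ->
  energy f N x <= energy f N (equidistant rho) -> x = equidistant rho.
Proof.
move=> sPhi xle.
have NR : 0 < N%:R / 2 :> R by rewrite divr_gt0 ?ltr0n.
have D35 : D 3 + D 5 <= 0.
  by apply: le_trans energy_excess _; rewrite subr_le0 ler_pM2l.
have D3 : 0 <= D 3 by exact: D_ge0.
have D5 : 0 <= D 5 by exact: D_ge0.
have D3le : D 3 <= 0 by apply: le_trans D35; rewrite lerDl.
have D5le : D 5 <= 0 by apply: le_trans D35; rewrite lerDr.
have x3 := strict_jensen_eq N0 rho0 Px _ 3 isT (Phip_convex _ _) sPhi D3le.
have x5 := strict_jensen_eq N0 rho0 Px _ 5 isT (Phip_convex _ _) sPhi D5le.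
have x1 k : x (k + 1) = x k + rho^-1.
  have := x3 (k - 5%:Z); have := x3 (k - 2%:Z); have := x5 (k - 5%:Z).
  rewrite subrK (_ : k - 5%:Z + 3%:Z = k - 2%:Z); last by lia.
  rewrite (_ : k - 2%:Z + 3%:Z = k + 1); last by lia.
  lra.
case: Px => x0 _ _; apply/funext; rewrite /equidistant; elim=> [|k IH|k IH].
- by rewrite x0 mul0r.
- have -> : k.+1%:Z = k%:Z + 1 by lia.
  by rewrite x1 IH intrD mulrDl mul1r.
- have xk : - k%:Z = - k.+1%:Z + 1 by lia.
  by apply: (addIr rho^-1); rewrite -x1 -xk IH xk intrD mulrDl mul1r.
Qed.

End minimality.

Theorem theorem2p2 (R : realType) (f Phip Phim : species -> species -> R -> R)
  (f_mirror : forall (a b : species) (x : R), f a b (- x) = f a b x)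
  (f_sym : forall x : R, f Sp2 Sp1 x = f Sp1 Sp2 x)
  (f_decomp : forall (a b : species) (x : R),
     f a b x = Phip a b `|x| - Phim a b `|x|)
  (Phip_convex : forall a b : species,
     convex_function (`[0, +oo[%classic : set R) (Phip a b))
  (Phim_convex : forall a b : species,
     convex_function (`[0, +oo[%classic : set R) (Phim a b))
  (Phip_tempered : forall a b : species, strongly_tempered (Phip a b))
  (Phim_tempered : forall a b : species, strongly_tempered (Phim a b))
  (F_convex : convex_function (`]0, +oo[%classic : set R)
     (nn_potential Phip Phim)) :
  forall (rho : R) (N : nat), 0 < rho -> (0 < N)%N -> ~~ odd N ->
    is_minimizer (energy f N) (periodic_conf rho N) (equidistant rho) /\
    (strictly_convex_function (`]0, +oo[%classic : set R) (Phip Sp1 Sp2) ->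
     is_unique_minimizer (energy f N) (periodic_conf rho N) (equidistant rho)).
Proof.
move=> rho N rho0 N0 N2.
(* Distances are positive, so the argument runs on the open half-line, where F is convex as well. *)
have half (g : R -> R) : convex_function (`[0, +oo[%classic : set R) g ->
    convex_function (`]0, +oo[%classic : set R) g.
  move=> cg t y z; rewrite !inE /= !in_itv /= !andbT => y0 z0.
  by apply: cg; rewrite inE /= in_itv /= andbT ltW.
have cp a b := half _ (Phip_convex a b).
have cm a b := half _ (Phim_convex a b).
have Pe := @periodic_equidistant _ rho N rho0.
have eqmin : is_minimizer (energy f N) (periodic_conf rho N) (equidistant rho).
  split=> // y Py.
  exact: (equidistant_le f_mirror f_sym f_decomp cp cm Phip_tempered Phim_tempered
    F_convex N0 N2 rho0 Py).
split=> // sPhi; split=> // y [Py ymin].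
exact: (equidistant_unique f_mirror f_sym f_decomp cp cm Phip_tempered Phim_tempered
  F_convex N0 N2 rho0 Py sPhi (ymin _ Pe)).
Qed.
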